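(* Let $A=R/I$ be an extremal Artin Gorenstein local $K$-algebra of socle degree $s$. If $s\le 4$, then $A$ is canonically graded.
   Context: $K$ is an algebraically closed field of characteristic zero, $R=K[[x_1,\dots,x_n]]$ is the formal power series ring with maximal ideal $\mathcal M=(x_1,\dots,x_n)$, and $A=R/I$ is an Artin local ring of embedding dimension $n$ with maximal ideal $\mathfrak m=\mathcal M/I$. The socle degree $s$ of $A$ is the largest integer $j$ with $\mathfrak m^j\neq 0$. The socle is $\mathrm{Soc}(A)=0:\mathfrak m$ and the type of $A$ is $\dim_K \mathrm{Soc}(A)$; $A$ is Gorenstein if its type is $1$. The Hilbert function is $h_i(A)=\dim_K \mathfrak m^i/\mathfrak m^{i+1}$. An Artin Gorenstein local $K$-algebra $A$ of socle degree $s$ and embedding dimension $n$ is called extremal (or compressed) Gorenstein if $$h_i(A)=\min\left\{\binom{n+i-1}{i},\ \binom{n+s-i-1}{s-i}\right\}\quad\text{for all } 0\le i\le s.$$ A local $K$-algebra $(A,\mathfrak m)$ is canonically graded if there exists a $K$-algebra isomorphism between $A$ and its associated graded ring $gr_{\mathfrak m}(A)=\bigoplus_{i\ge 0}\mathfrak m^i/\mathfrak m^{i+1}$. *)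

(* Defs.v *)
From HB Require Import structures.
From mathcomp Require Import all_boot all_order all_algebra.
From mathcomp Require Import boolp.
From mathcomp Require Import mpoly.

Set Implicit Arguments.
Unset Strict Implicit.
Unset Printing Implicit Defensive.

Import GRing.Theory.

Local Open Scope ring_scope.
Local Open Scope quotient_scope.

Reserved Notation "{ 'fps' K [ n ] }" (K at level 2, format "{ 'fps'  K [ n ] }").

(* K[[x_1, ..., x_n]]: a series is its family of coefficients, indexed by the
   monomials of multinomials' mpoly, and the product is the Cauchy product. *)

Section PowerSeries.
Variables (n : nat) (K : fieldType).

Record fps := Fps { fcoef :> 'X_{1..n} -> K }.

Lemma fpsP (f g : fps) : f =1 g -> f = g.
Proof. by case: f g => [f] [g] /= /funext ->. Qed.

HB.instance Definition _ := gen_eqMixin fps.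
HB.instance Definition _ := gen_choiceMixin fps.

Definition fps0 := Fps (fun=> 0).
Definition fps1 := Fps (fun m => (m == 0%MM)%:R).
Definition fps_opp (f : fps) := Fps (fun m => - f m).
Definition fps_add (f g : fps) := Fps (fun m => f m + g m).
Definition fps_scale (c : K) (f : fps) := Fps (fun m => c * f m).
Definition fps_mul (f g : fps) := Fps (fun m =>
  \sum_(k : 'X_{1..n < (mdeg m).+1, (mdeg m).+1} | m == (k.1 + k.2)%MM)
     f k.1 * g k.2).
Definition fpsX (i : 'I_n) := Fps (fun m => (m == U_(i)%MM)%:R).

Fact fps_addA : associative fps_add.
Proof. by move=> f g h; apply: fpsP => m /=; rewrite addrA. Qed.
Fact fps_addC : commutative fps_add.
Proof. by move=> f g; apply: fpsP => m /=; rewrite addrC. Qed.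
Fact fps_add0 : left_id fps0 fps_add.
Proof. by move=> f; apply: fpsP => m /=; rewrite add0r. Qed.
Fact fps_addN : left_inverse fps0 fps_opp fps_add.
Proof. by move=> f; apply: fpsP => m /=; rewrite addNr. Qed.

HB.instance Definition _ :=
  GRing.isZmodule.Build fps fps_addA fps_addC fps_add0 fps_addN.

Definition fps_trunc d (f : fps) : {mpoly K[n]} :=
  \sum_(k : 'X_{1..n < d}) f k *: 'X_[k].

Lemma fps_truncE d f m : (mdeg m < d)%N -> (fps_trunc d f)@_m = f m.
Proof.
move=> md; rewrite /fps_trunc raddf_sum /= (bigD1 (BMultinom md)) //=.
rewrite mcoeffZ mcoeffX eqxx mulr1 big1 ?addr0 // => k nk.
by rewrite mcoeffZ mcoeffX -(bmeqP k (BMultinom md)) (negPf nk) mulr0.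
Qed.

Lemma fps_mulE d (f g : fps) (P Q : {mpoly K[n]}) m :
  (forall k, (mdeg k < d)%N -> P@_k = f k) ->
  (forall k, (mdeg k < d)%N -> Q@_k = g k) ->
  (mdeg m < d)%N -> (P * Q)@_m = fps_mul f g m.
Proof.
move=> Pf Qg md; rewrite mcoeffM /=; apply: eq_bigr => k _.
by rewrite Pf ?Qg // (leq_trans (bmdeg _)).
Qed.

Fact fps_mulA : associative fps_mul.
Proof.
move=> f g h; apply: fpsP => m; pose d := (mdeg m).+1.
pose T := fps_trunc d; have TE u k : (mdeg k < d)%N -> (T u)@_k = u k.
  exact: fps_truncE.
rewrite -(@fps_mulE d _ _ (T f) (T g * T h)) //; first last.
- by move=> k; apply: fps_mulE; apply: TE.
- exact: TE.
rewrite mulrA; apply: (@fps_mulE d) => //; last exact: TE.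
by move=> k; apply: fps_mulE; apply: TE.
Qed.

Fact fps_mulC : commutative fps_mul.
Proof.
move=> f g; apply: fpsP => m; pose d := (mdeg m).+1.
pose T := fps_trunc d; have TE u k : (mdeg k < d)%N -> (T u)@_k = u k.
  exact: fps_truncE.
by rewrite -(@fps_mulE d _ _ (T f) (T g)) // 1?mulrC; [apply: (@fps_mulE d) |..];
  rewrite //; apply: TE.
Qed.

Fact fps_mul1 : left_id fps1 fps_mul.
Proof.
move=> f; apply: fpsP => m; pose d := (mdeg m).+1.
rewrite -(@fps_mulE d _ _ 1 (fps_trunc d f)) ?mul1r ?fps_truncE //.
- by move=> k _; rewrite mcoeff1.
- by move=> k; apply: fps_truncE.
Qed.

Fact fps_mulDl : left_distributive fps_mul fps_add.
Proof.
move=> f g h; apply: fpsP => m /=; rewrite -big_split /=.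
by apply: eq_bigr => k _; rewrite mulrDl.
Qed.

Fact fps1_neq0 : fps1 != fps0.
Proof.
apply/eqP => /(congr1 (fun f : fps => f 0%MM)) /= /eqP.
by rewrite eqxx oner_eq0.
Qed.

HB.instance Definition _ := GRing.Zmodule_isComNzRing.Build fps
  fps_mulA fps_mulC fps_mul1 fps_mulDl fps1_neq0.

Fact fps_scaleA a b f : fps_scale a (fps_scale b f) = fps_scale (a * b) f.
Proof. by apply: fpsP => m /=; rewrite mulrA. Qed.
Fact fps_scale1 : left_id 1 fps_scale.
Proof. by move=> f; apply: fpsP => m /=; rewrite mul1r. Qed.
Fact fps_scaleDr : right_distributive fps_scale +%R.
Proof. by move=> a f g; apply: fpsP => m /=; rewrite mulrDr. Qed.
Fact fps_scaleDl f : {morph fps_scale^~ f : a b / a + b}.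
Proof. by move=> a b; apply: fpsP => m /=; rewrite mulrDl. Qed.

HB.instance Definition _ := GRing.Zmodule_isLmodule.Build K fps
  fps_scaleA fps_scale1 fps_scaleDr fps_scaleDl.

Fact fps_scaleAl a (f g : fps) : a *: (f * g) = (a *: f) * g.
Proof.
apply: fpsP => m /=; rewrite mulr_sumr; apply: eq_bigr => k _.
by rewrite mulrA.
Qed.

HB.instance Definition _ := GRing.Lmodule_isLalgebra.Build K fps fps_scaleAl.
HB.instance Definition _ := GRing.Lalgebra_isComAlgebra.Build K fps.

Lemma fps_coefD (f g : fps) m : (f + g) m = f m + g m. Proof. by []. Qed.
Lemma fps_coefB (f g : fps) m : (f - g) m = f m - g m. Proof. by []. Qed.
Lemma fps_coef_sum (I : Type) (r : seq I) (P : pred I) (F : I -> fps) m :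
  (\sum_(i <- r | P i) F i) m = \sum_(i <- r | P i) F i m.
Proof. exact: (big_morph (fun f : fps => f m) (fun f g => fps_coefD f g m)). Qed.

Lemma fps_coefM (f g : fps) m : (f * g) m =
  \sum_(k : 'X_{1..n < (mdeg m).+1, (mdeg m).+1} | m == (k.1 + k.2)%MM)
     f k.1 * g k.2.
Proof. by []. Qed.

Lemma fps_coef0M (f g : fps) : (f * g) 0%MM = f 0%MM * g 0%MM.
Proof.
rewrite -(@fps_mulE 1 _ _ (fps_trunc 1 f) (fps_trunc 1 g)) ?mdeg0 //;
  try by move=> k; apply: fps_truncE.
by rewrite rmorphM /= !fps_truncE ?mdeg0.
Qed.

Lemma fps_exp_coef (f : fps) k m : f 0%MM = 0 -> (mdeg m < k)%N ->
  (f ^+ k) m = 0.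
Proof.
move=> f0; elim: k m => // k IHk m mk; rewrite exprS fps_coefM big1 // => -[i j].
move=> /= /eqP mij; have [i0|i_gt0] := posnP (mdeg i).
  by move/eqP: i0; rewrite mdeg_eq0 => /eqP ->; rewrite f0 mul0r.
rewrite IHk ?mulr0 //; rewrite mij mdegD in mk.
by rewrite -ltnS (leq_trans _ mk) // ltnS -add1n leq_add2r.
Qed.

Lemma fps_inv1B (f : fps) : f 0%MM = 0 -> exists g : fps, g * (1 - f) = 1.
Proof.
move=> f0; pose G N : fps := \sum_(k < N) f ^+ k.
have GE N m : (mdeg m < N)%N -> G N m = G (mdeg m).+1 m.
  move=> mN; rewrite /G -(subnKC mN) big_split_ord fps_coefD.
  rewrite [X in _ + X]fps_coef_sum [X in _ + X]big1 ?addr0 // => k _.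
  by apply: fps_exp_coef; rewrite // ltnS leq_addr.
exists (Fps (fun m => G (mdeg m).+1 m)); apply: fpsP => m.
transitivity ((G (mdeg m).+1 * (1 - f)) m).
  by rewrite !fps_coefM; apply: eq_bigr => k _ /=; rewrite (GE (mdeg m).+1) ?bmdeg.
have -> : G (mdeg m).+1 * (1 - f) = 1 - f ^+ (mdeg m).+1.
  by rewrite mulrC -opprB mulNr -subrX1 opprB.
by rewrite fps_coefB fps_exp_coef ?subr0.
Qed.

Definition fps_max : pred fps := fun f =>
  `[< exists g : 'I_n -> fps, f = \sum_i g i * fpsX i >].

Lemma fps_max_coef0 f : f \in fps_max -> f 0%MM = 0.
Proof.
move=> /asboolP[g ->]; rewrite fps_coef_sum big1 // => i _.
by rewrite fps_coef0M /= eq_sym mnm1_eq0 mulr0.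
Qed.

Fact fps_max_closed : idealr_closed fps_max.
Proof.
split.
- by apply/asboolP; exists (fun=> 0); rewrite big1 // => i _; rewrite mul0r.
- by apply/negP => /fps_max_coef0 /= /eqP; rewrite eqxx oner_eq0.
- move=> a _ _ /asboolP[g ->] /asboolP[h ->]; apply/asboolP.
  exists (fun i => a * g i + h i); rewrite mulr_sumr -big_split /=.
  by apply: eq_bigr => i _; rewrite mulrDl mulrA.
Qed.

HB.instance Definition _ := isIdealr.Build fps fps_max fps_max_closed.

End PowerSeries.

Notation "{ 'fps' K [ n ] }" := (fps n K) : type_scope.

Section QuotientAlgebra.
Variables (K : fieldType) (R : comAlgType K) (I : idealr R).

Definition quot_scale c := lift_op1 {ideal_quot I} (fun x => c *: x).

Fact pi_quot_scale c : {morph \pi : x / c *: x >-> quot_scale c x}.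
Proof.
move=> x; unlock quot_scale; apply/eqP; rewrite piE Quotient.equivE -scalerBr.
by rewrite -mulr_algl idealMr // Quotient.idealrBE reprK.
Qed.

Fact quot_scaleA a b x : quot_scale a (quot_scale b x) = quot_scale (a * b) x.
Proof. by rewrite -[x]reprK -!pi_quot_scale scalerA. Qed.
Fact quot_scale1 : left_id 1 quot_scale.
Proof. by move=> x; rewrite -[x]reprK -!pi_quot_scale scale1r. Qed.
Fact quot_scaleDr : right_distributive quot_scale +%R.
Proof.
move=> a x y; rewrite -[x]reprK -[y]reprK -!pi_quot_scale -!rmorphD /=.
by rewrite -pi_quot_scale scalerDr.
Qed.
Fact quot_scaleDl x : {morph quot_scale^~ x : a b / a + b}.
Proof.
by move=> a b; rewrite -[x]reprK -!pi_quot_scale -rmorphD /= scalerDl.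
Qed.

HB.instance Definition _ := GRing.Zmodule_isLmodule.Build K {ideal_quot I}
  quot_scaleA quot_scale1 quot_scaleDr quot_scaleDl.

Fact quot_scaleAl a (x y : {ideal_quot I}) : a *: (x * y) = (a *: x) * y.
Proof.
rewrite -[x]reprK -[y]reprK -rmorphM /= -[LHS]pi_quot_scale scalerAl.
by rewrite rmorphM /= pi_quot_scale.
Qed.

HB.instance Definition _ :=
  GRing.Lmodule_isLalgebra.Build K {ideal_quot I} quot_scaleAl.
HB.instance Definition _ :=
  GRing.Lalgebra_isComAlgebra.Build K {ideal_quot I}.
HB.instance Definition _ := GRing.isScalable.Build K R {ideal_quot I} *:%R
  \pi_{ideal_quot I} pi_quot_scale.

End QuotientAlgebra.

Section LocalAlgebra.
Variables (K : fieldType) (A : comAlgType K).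
Implicit Types S T J : pred A.

Definition is_ideal J : Prop :=
  [/\ 0 \in J, {in J &, forall x y, x + y \in J}
    & forall a, {in J, forall x, a * x \in J}].

Definition artinian : Prop :=
  forall J : nat -> pred A, (forall k, is_ideal (J k)) ->
    (forall k, {subset J k.+1 <= J k}) ->
  exists N, forall k, (N <= k)%N -> J k =i J N.

Definition ideal_mul S T : pred A := fun x =>
  `[< exists2 r : seq (A * A),
        all (fun p => (p.1 \in S) && (p.2 \in T)) r
      & x = \sum_(p <- r) p.1 * p.2 >].

Fixpoint ideal_exp S k : pred A :=
  if k is k'.+1 then ideal_mul S (ideal_exp S k') else predT.

Definition socle S : pred A := fun x => `[< {in S, forall a, a * x = 0} >].

(* dim_K (U / W) = d, for subspaces W and U of A with W contained in U *)
Definition has_qdim (U W : pred A) (d : nat) : Prop :=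
  exists e : 'I_d -> A,
  [/\ forall i, e i \in U,
      forall c : 'I_d -> K, \sum_i c i *: e i \in W -> forall i, c i = 0
    & forall u, u \in U -> exists c : 'I_d -> K, u - \sum_i c i *: e i \in W].

(* From here on A is meant to be local, with maximal ideal m. *)

Definition hilbert_is (m : pred A) (i d : nat) : Prop :=
  has_qdim (ideal_exp m i) (ideal_exp m i.+1) d.

Definition embedding_dim (m : pred A) (n : nat) : Prop := hilbert_is m 1 n.

Definition socle_degree (m : pred A) (s : nat) : Prop :=
  (exists2 x, x \in ideal_exp m s & x != 0) /\
  (forall j x, (s < j)%N -> x \in ideal_exp m j -> x = 0).

Definition has_type (m : pred A) (t : nat) : Prop :=
  has_qdim (socle m) (pred1 0) t.

Definition gorenstein (m : pred A) : Prop := has_type m 1.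

(* For n = i = 0 truncated subtraction gives 'C(0, 0) = 1, which is the usual
   value of binom(-1, 0); likewise for the second binomial. *)
Definition extremal_gorenstein (n s : nat) (m : pred A) : Prop :=
  gorenstein m /\
  forall i, (i <= s)%N ->
    hilbert_is m i (minn 'C(n + i - 1, i) 'C(n + s - i - 1, s - i)).

Lemma ideal_expP S k : is_ideal (ideal_exp S k).
Proof.
elim: k => [|k [_ _ IHk]] //=; split.
- by apply/asboolP; exists [::]; rewrite ?big_nil.
- move=> _ _ /asboolP[r rP ->] /asboolP[t tP ->]; apply/asboolP.
  by exists (r ++ t); rewrite ?big_cat ?all_cat ?rP.
- move=> a _ /asboolP[r rP ->]; apply/asboolP.
  exists [seq (p.1, a * p.2) | p <- r].
    rewrite all_map; apply: sub_all rP => p /= /andP[-> p2].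
    by rewrite IHk.
  by rewrite big_map mulr_sumr; apply: eq_bigr => p _; rewrite /= mulrCA.
Qed.

Lemma ideal_exp_sum S k (J : Type) (r : seq J) (P : pred J) (F : J -> A) :
  (forall j, P j -> F j \in ideal_exp S k) ->
  \sum_(j <- r | P j) F j \in ideal_exp S k.
Proof.
by move=> FP; have [S0 SD _] := ideal_expP S k;
  apply: (big_ind (fun x => x \in ideal_exp S k)).
Qed.

Lemma ideal_expM S i j x y : x \in ideal_exp S i -> y \in ideal_exp S j ->
  x * y \in ideal_exp S (i + j).
Proof.
elim: i x => [|i IHi] x; first by move=> _ yj; have [_ _] := ideal_expP S j; apply.
move=> /asboolP[r /allP rP ->] yj; apply/asboolP.
exists [seq (p.1, p.2 * y) | p <- r].
  apply/allP => _ /mapP[p /rP /andP[p1 p2] ->] /=.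
  by rewrite p1; apply: IHi.
by rewrite big_map mulr_suml; apply: eq_bigr => p _; rewrite /= mulrA.
Qed.

Lemma ideal_exp1 (m : idealr A) : ideal_exp m 1 =i m.
Proof.
move=> x; apply/asboolP/idP => [[r /allP rP ->]|xm].
  by rewrite big_seq; apply: rpred_sum => p /rP /andP[p1 _]; rewrite mulrC idealMr.
by exists [:: (x, 1)]; rewrite /= ?xm ?big_seq1 ?mulr1.
Qed.

End LocalAlgebra.

Section AssociatedGraded.
Variables (K : fieldType) (A : comAlgType K) (m : idealr A).

(* The direct sum of the m^i is the subring {p | forall i, p`_i \in m^i} of
   A[t]; the associated graded ring is its quotient by the direct sum of the
   m^(i+1), so that [a t^i] is the class of a in m^i / m^(i+1) and the product
   is induced by m^i x m^j -> m^(i+j). *)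

Definition rees_pred : pred {poly A} := fun p =>
  `[< forall i, p`_i \in ideal_exp m i >].

Fact rees_subring_closed : subring_closed rees_pred.
Proof.
split.
- apply/asboolP => i; rewrite coef1; case: i => //= i.
  by have [] := ideal_expP m i.+1.
- move=> p q /asboolP pP /asboolP qP; apply/asboolP => i.
  have [_ DI MI] := ideal_expP m i.
  by rewrite coefB; apply: DI => //; rewrite -mulN1r; apply: MI.
- move=> p q /asboolP pP /asboolP qP; apply/asboolP => i.
  rewrite coefM; apply: ideal_exp_sum => j _.
  have := ideal_expM (pP j) (qP (i - j)%N).
  by rewrite subnKC // -ltnS.
Qed.

Record rees := Rees { rees_val :> {poly A}; _ : rees_val \in rees_pred }.

HB.instance Definition _ := [isSub for rees_val].
HB.instance Definition _ := [Choice of rees by <:].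
HB.instance Definition _ :=
  GRing.isSubringClosed.Build {poly A} rees_pred rees_subring_closed.
HB.instance Definition _ := [SubChoice_isSubComNzRing of rees by <:].

Fact rees_scale_subproof (c : K) (p : rees) :
  c%:A *: rees_val p \in rees_pred.
Proof.
have /asboolP pP := valP p; apply/asboolP => i; rewrite coefZ.
by have [_ _] := ideal_expP m i; apply.
Qed.

Definition rees_scale c p := Rees (rees_scale_subproof c p).

Fact rees_scaleA a b p : rees_scale a (rees_scale b p) = rees_scale (a * b) p.
Proof. by apply: val_inj; rewrite /= scalerA -scalerAl mul1r scalerA. Qed.
Fact rees_scale1 : left_id 1 rees_scale.
Proof. by move=> p; apply: val_inj; rewrite /= !scale1r. Qed.
Fact rees_scaleDr : right_distributive rees_scale +%R.
Proof. by move=> a p q; apply: val_inj; rewrite /= scalerDr. Qed.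
Fact rees_scaleDl p : {morph rees_scale^~ p : a b / a + b}.
Proof. by move=> a b; apply: val_inj; rewrite /= !scalerDl. Qed.

HB.instance Definition _ := GRing.Zmodule_isLmodule.Build K rees
  rees_scaleA rees_scale1 rees_scaleDr rees_scaleDl.

Fact rees_scaleAl a (p q : rees) : a *: (p * q) = (a *: p) * q.
Proof. by apply: val_inj; rewrite /= scalerAl. Qed.

HB.instance Definition _ := GRing.Lmodule_isLalgebra.Build K rees rees_scaleAl.
HB.instance Definition _ := GRing.Lalgebra_isComAlgebra.Build K rees.

Definition rees_shift : pred rees := fun p =>
  `[< forall i, (rees_val p)`_i \in ideal_exp m i.+1 >].

Fact rees_shift_closed : idealr_closed rees_shift.
Proof.
split.
- by apply/asboolP => i; rewrite coef0; have [] := ideal_expP m i.+1.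
- apply/asboolP => /(_ 0); rewrite coef1 /=.
  by rewrite -[X in X -> _]/(is_true (1 \in ideal_exp m 1)) ideal_exp1 idealr1.
- move=> a p q /asboolP pP /asboolP qP; apply/asboolP => i.
  have /asboolP aP := valP a; have [_ DI MI] := ideal_expP m i.+1.
  rewrite coefD; apply: DI => //; rewrite coefM; apply: ideal_exp_sum => j _.
  have := ideal_expM (aP j) (pP (i - j)%N).
  by rewrite addnS subnKC // -ltnS.
Qed.

HB.instance Definition _ := isIdealr.Build rees rees_shift rees_shift_closed.

Definition assoc_gr := {ideal_quot (rees_shift : idealr rees)}.
HB.instance Definition _ := GRing.ComAlgebra.on assoc_gr.

Definition canonically_graded : Prop :=
  exists f : {lrmorphism A -> assoc_gr}, bijective f.

End AssociatedGraded.

Section MaximalIdeal.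
Variables (n : nat) (K : fieldType) (I : idealr {fps K[n]}).

Definition quot_max : pred {ideal_quot I} := fun a =>
  `[< exists2 f, f \in @fps_max n K & a = \pi f >].

Fact quot_max_closed : idealr_closed quot_max.
Proof.
split.
- by apply/asboolP; exists 0; rewrite ?rpred0 ?rmorph0.
- apply/asboolP => -[f /fps_max_coef0 /fps_inv1B[g gf] /eqP].
  rewrite -[1](rmorph1 \pi_{ideal_quot I}) -Quotient.idealrBE => f1I.
  by have := idealMr g f1I; rewrite gf idealr1.
- move=> a _ _ /asboolP[f fM ->] /asboolP[g gM ->]; apply/asboolP.
  exists (repr a * f + g); first by rewrite rpredD ?idealMr.
  by rewrite rmorphD rmorphM /= reprK.
Qed.

HB.instance Definition _ :=
  isIdealr.Build {ideal_quot I} quot_max quot_max_closed.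

End MaximalIdeal.

(* Main.v *)
(* Let s be the socle degree, e a generator of the socle m^s, and y a system of
   generators of m. A is graded by the degree in y as soon as no nonzero value
   p(y) with deg p < s lies on the line K e: a homogeneous form with p(y) <> 0
   then has a complementary form q with (p q)(y) = e, which forces the kernel of
   K[x] -> A, x |-> y, to be homogeneous and equal to the kernel of the graded
   map K[x] -> gr A.

   To find such y for s >= 2, fix a basis v of m^(s-1)/m^s and let phi be the
   e-coordinate on m^(s-1). The only obstruction is phi(y^c) for |c| = s - 1,
   because extremality with s <= 4 makes the monomials of degree d <= s - 2
   independent modulo m^(d+1). Replacing y_k by y_k + q_k with q_k in m^2
   changes y^c to y^c + sum_k c_k y^(c-k) q_k, since m^(s+1) = 0. The equality
   0 : m^2 = m^(s-1) implies that every linear functional on the forms of degree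
   s - 2 is the product with an element of m^2, so y^b q_k can be taken equal to
   - phi(y^(b+k)) e / (s - 1) for all |b| = s - 2, and this choice kills
   phi(y^c) because sum_k c_k = s - 1. *)
Require Import Defs.
From HB Require Import structures.
From mathcomp Require Import all_boot all_order all_algebra.
From mathcomp Require Import boolp mpoly ring zify.
Set Implicit Arguments.
Unset Strict Implicit.
Unset Printing Implicit Defensive.
Import GRing.Theory.
Local Open Scope ring_scope.
Local Open Scope quotient_scope.

Local Arguments ideal_exp : simpl never.

(** Both [A] and [B] are [P] modulo the same ideal, so any preimage of a point of [A] may be sent
    through [g]. Here [P] will be K[x], and [B] will be gr A. *)
Lemma lrmorphism_of_same_kernel (K : fieldType) (P A B : comAlgType K)
    (f : {lrmorphism P -> A}) (g : {lrmorphism P -> B}) :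
  (forall a, exists p, f p = a) -> (forall b, exists p, g p = b) ->
  (forall p, f p = 0 <-> g p = 0) ->
  exists h : {lrmorphism A -> B}, bijective h.
Proof.
move=> f_surj g_surj same_ker.
have [r rK] := choice f_surj; have [t tK] := choice g_surj.
have eqfg p q : f p = f q <-> g p = g q.
  split=> /eqP; rewrite -subr_eq0 -rmorphB => /eqP /same_ker /eqP.
    by rewrite rmorphB subr_eq0 => /eqP.
  by rewrite rmorphB subr_eq0 => /eqP.
pose h a := g (r a).
have hE p : h (f p) = g p by apply/eqfg; rewrite rK.
have h_lin : linear h.
  move=> c a b; rewrite -[a]rK -[b]rK -linearP !hE linearP.
  by [].
have h_mul : monoid_morphism h.
  split=> [|a b]; first by rewrite -(rmorph1 f) hE rmorph1.
  by rewrite -[a]rK -[b]rK -rmorphM !hE rmorphM.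
pose H1 := GRing.isMonoidMorphism.Build A B h h_mul.
pose H2 := GRing.isLinear.Build K A B _ h h_lin.
pose H : {lrmorphism A -> B} := HB.pack h H1 H2.
exists H; exists (fun b => f (t b)) => [a|b] /=.
  by rewrite -[RHS]rK; apply/eqfg; rewrite tK.
by rewrite hE tK.
Qed.

(** * Evaluation of polynomials at elements of [A] *)

Section PolynomialEvaluation.
Variables (K : fieldType) (A : comAlgType K) (n : nat) (y : 'I_n -> A).

Definition mev : {mpoly K[n]} -> A := mmap (in_alg A) y.

HB.instance Definition _ := GRing.RMorphism.on mev.

Fact mev_is_scalable : scalable mev.
Proof. by move=> c p; rewrite /mev mmapZ mulr_algl. Qed.

HB.instance Definition _ :=
  GRing.isScalable.Build K {mpoly K[n]} A *:%R mev mev_is_scalable.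

Lemma mevX mn : mev 'X_[mn] = \prod_i y i ^+ mn i.
Proof. exact: mmapX. Qed.

Lemma mevXU i : mev 'X_i = y i.
Proof. by rewrite /mev mmapX mmap1U. Qed.

Lemma mevXD m1 m2 : mev 'X_[m1 + m2] = mev 'X_[m1] * mev 'X_[m2].
Proof. by rewrite mpolyXD rmorphM. Qed.

Lemma mevE p : mev p = \sum_(mn <- msupp p) p@_mn *: mev 'X_[mn].
Proof.
rewrite {1}[p]mpolyE linear_sum; apply: eq_bigr => mn _.
by rewrite linearZ.
Qed.

End PolynomialEvaluation.

(** * Powers of an ideal as subspaces *)

Section IdealPowers.
Variables (K : fieldType) (A : comAlgType K) (S : pred A).

Fact ideal_exp_submod_closed k : submod_closed (ideal_exp S k).
Proof.
have [S0 SD SM] := ideal_expP S k.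
by split=> // c a b aS bS; apply: SD => //; rewrite -mulr_algl; apply: SM.
Qed.

HB.instance Definition _ k := GRing.isSubmodClosed.Build K A (ideal_exp S k)
  (ideal_exp_submod_closed k).

Lemma ideal_exp_mull k a x : x \in ideal_exp S k -> a * x \in ideal_exp S k.
Proof. by have [_ _] := ideal_expP S k; apply. Qed.

Lemma ideal_exp_sub i j : (i <= j)%N ->
  {subset ideal_exp S j <= ideal_exp S i}.
Proof.
move=> /subnK <-; elim: (j - i)%N => // k IHk x.
rewrite addSn => /asboolP[r /allP rP ->]; apply: IHk.
by rewrite big_seq rpred_sum // => p /rP /andP[_ ?]; apply: ideal_exp_mull.
Qed.

Lemma ideal_exp_ind k (P : A -> Prop) :
  P 0 -> (forall a b, P a -> P b -> P (a + b)) ->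
  (forall a b, a \in S -> b \in ideal_exp S k -> P (a * b)) ->
  forall x, x \in ideal_exp S k.+1 -> P x.
Proof.
move=> P0 PD PM x /asboolP[r /allP rP ->].
by rewrite big_seq; apply: big_ind => // p /rP /andP[]; apply: PM.
Qed.

End IdealPowers.

(* The [y i] span [m / m^2]; they generate [m] once [m] is nilpotent. *)
Definition local_coords (K : fieldType) (A : comAlgType K) (m : idealr A)
    (n : nat) (y : 'I_n -> A) : Prop :=
  [/\ forall a, exists c : K, a - c%:A \in m,
      forall i, y i \in m
    & forall a, a \in m ->
      exists c : 'I_n -> K, a - \sum_i c i *: y i \in ideal_exp m 2].

(** * Approximation by forms in local coordinates *)

Section LocalCoordinates.
Variables (K : fieldType) (A : comAlgType K) (m : idealr A).
Variables (n : nat) (y : 'I_n -> A).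
Hypothesis yP : local_coords m y.

Lemma mevX_exp mn : mev y 'X_[mn] \in ideal_exp m (mdeg mn).
Proof.
have [_ ym _] := yP; rewrite mevX mdegE.
elim/big_rec2: _ => // i a d _ ad.
apply: ideal_expM ad; elim: (mn i) => // k IHk.
by rewrite exprS -add1n; apply: ideal_expM; rewrite ?ideal_exp1.
Qed.

Lemma mev_homog_exp d p : p \is d.-homog -> mev y p \in ideal_exp m d.
Proof.
move=> /dhomogP pd; rewrite mevE big_seq rpred_sum // => mn /pd <-.
by rewrite rpredZ ?mevX_exp.
Qed.

(** If l and q are values of forms approximating a in m and b in m^d, then a b - l q = a (b - q) +
    (a - l) q gains one order. *)
Lemma ideal_exp_homog d a : a \in ideal_exp m d ->
  exists2 p : {mpoly K[n]}, p \is d.-homog & a - mev y p \in ideal_exp m d.+1.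
Proof.
have [resP ym genP] := yP; elim: d a => [|d IHd] a.
  move=> _; have [c cP] := resP a; exists c%:A;
    first by rewrite rpredZ ?dhomog1.
  by rewrite ideal_exp1 linearZ rmorph1.
move: a; apply: ideal_exp_ind =>
  [|a b [p pd ap] [q qd bq]|a b am /IHd[q qd bq]].
- by exists 0; rewrite ?rpred0 // rmorph0 subr0 rpred0.
- exists (p + q); first by rewrite rpredD.
  by rewrite rmorphD opprD addrACA rpredD.
have [c cP] := genP a am; pose p : {mpoly K[n]} := \sum_i c i *: 'X_i.
have evp : mev y p = \sum_i c i *: y i.
  by rewrite linear_sum; apply: eq_bigr => i _; rewrite linearZ /= mevXU.
have pd : p \is 1.-homog.
  by rewrite rpred_sum // => i _; rewrite rpredZ // dhomogX /= mdeg1.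
exists (p * q); first by rewrite -add1n dhomogM.
rewrite rmorphM /= evp.
have -> : a * b - (\sum_i c i *: y i) * mev y q =
    a * (b - mev y q) + (a - \sum_i c i *: y i) * mev y q.
  by rewrite mulrBr mulrBl addrA subrK.
rewrite rpredD //.
  by have := ideal_expM (i := 1) (x := a) _ bq; apply; rewrite ideal_exp1.
exact: ideal_expM cP (mev_homog_exp qd).
Qed.

Lemma mev_surj s : (forall x, x \in ideal_exp m s.+1 -> x = 0) ->
  forall a, exists p, mev y p = a.
Proof.
move=> nilp a.
have descent k : forall d b, (d + k = s.+1)%N -> b \in ideal_exp m d ->
    exists p, mev y p = b.
  elim: k => [|k IHk] d b.
    by rewrite addn0 => -> /nilp ->; exists 0; rewrite rmorph0.
  rewrite addnS -addSn => dk /ideal_exp_homog[p _ /(IHk _ _ dk)[q qE]].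
  by exists (p + q); rewrite rmorphD /= qE addrC subrK.
exact: (descent s.+1 0).
Qed.

End LocalCoordinates.

(** * Degree bounds for forms and sums *)

Section HomogeneousSize.
Variables (n : nat) (K : fieldType).
Implicit Types p : {mpoly K[n]}.

Lemma msize_homog_le d p : p \is d.-homog -> (msize p <= d.+1)%N.
Proof. by move=> /dhomogP pd; apply/bigmax_leqP_seq => mn /pd ->. Qed.

Lemma msize_sum_le (I : Type) (r : seq I) (P : pred I)
    (F : I -> {mpoly K[n]}) k :
  (forall i, P i -> msize (F i) <= k)%N ->
  (msize (\sum_(i <- r | P i) F i) <= k)%N.
Proof.
move=> Fk; apply: leq_trans (mmeasure_sum _ _ _ _) _.
by elim/big_ind: _ => // a b ak bk; rewrite geq_max ak.
Qed.

End HomogeneousSize.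

(** * A criterion for being canonically graded *)

Section GradedCriterion.
Variables (K : fieldType) (A : comAlgType K) (m : idealr A).
Variables (n : nat) (y : 'I_n -> A).
Hypothesis yP : local_coords m y.

Lemma mpoly_split_degree (p : {mpoly K[n]}) k :
  exists2 q, p = \sum_(d < k) pihomog mdeg d p + pihomog mdeg k p + q
           & mev y q \in ideal_exp m k.+1.
Proof.
exists (\sum_(d < msize p) pihomog mdeg (k.+1 + d) p).
  rewrite {1}(@pihomog_partitionE _ _ mdeg (k.+1 + msize p) p) ?leq_addl //.
  by rewrite big_split_ord big_ord_recr.
rewrite linear_sum rpred_sum // => d _.
apply: (ideal_exp_sub (leq_addr d k.+1)).
by rewrite mev_homog_exp ?pihomogP.
Qed.

Fact rees_gen_subproof i : y i *: 'X \in rees_pred m.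
Proof.
have [_ ym _] := yP; apply/asboolP => j; rewrite coefZ coefX.
have [->|_] := eqVneq j 1; first by rewrite mulr1 ideal_exp1.
by rewrite mulr0 rpred0.
Qed.

(** It represents the class of [y i] in m/m^2, the degree 1 part of gr A. *)
Definition rees_gen i : rees m := Rees (rees_gen_subproof i).

Lemma rees_val_mevX mn :
  rees_val (mev rees_gen 'X_[mn]) = mev y 'X_[mn] *: 'X^(mdeg mn).
Proof.
rewrite !mevX [LHS](rmorph_prod (val : rees m -> {poly A})).
under eq_bigr => i _ do rewrite rmorphXn exprZn.
by rewrite scaler_prod mdegE prodrXr.
Qed.

Lemma coef_rees_mev p d :
  (rees_val (mev rees_gen p))`_d = mev y (pihomog mdeg d p).
Proof.
rewrite mevE.
rewrite [rees_val _](raddf_sum (val : rees m -> {poly A})) coef_sum.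
rewrite pihomogE linear_sum big_mkcond /=.
rewrite [RHS]big_mkcond; apply: eq_bigr => mn _.
rewrite rees_val_mevX !coefZ coefXn mulr_algl eq_sym.
by case: eqP => _; rewrite ?mulr0 ?scaler0 // mulr1 linearZ.
Qed.

Variables (s : nat) (e : A).
Hypothesis nilp : forall x, x \in ideal_exp m s.+1 -> x = 0.
Hypothesis top_line : forall x, x \in ideal_exp m s -> exists c : K, x = c *: e.
Hypothesis e_neq0 : e != 0.
Hypothesis pairing : forall a, a != 0 -> exists b, a * b = e.
Hypothesis no_low : forall p c,
  (msize p <= s)%N -> mev y p = c *: e -> mev y p = 0.

(** Take g with p(y) g(y) = e. Components of g of degree above s - i contribute to m^(s+1) = 0;
    those below give a value of degree less than s on the line K e, which [no_low] kills. The
    component of degree s - i remains. *)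
Lemma mev_homog_dual i p : p \is i.-homog -> mev y p != 0 ->
  (i <= s)%N /\ exists2 q : {mpoly K[n]},
    q \is (s - i).-homog & mev y (p * q) = e.
Proof.
move=> pi p0; have is_ : (i <= s)%N.
  rewrite leqNgt; apply: contraNN p0 => si; apply/eqP/nilp.
  by apply: (ideal_exp_sub si); apply: mev_homog_exp.
split=> //; have [b] := pairing p0; have [g <-] := mev_surj yP nilp b.
have [r gE r_high] := mpoly_split_degree g (s - i).
set q := pihomog _ _ _ in gE; set l := \sum_(d < _) _ in gE.
have qd : q \is (s - i).-homog by exact: pihomogP.
move=> peE; exists q => //.
have pr0 : mev y p * mev y r = 0.
  by apply: nilp; rewrite -(subnKC is_) -addnS; apply: ideal_expM r_high;
    apply: mev_homog_exp.
have [c cE] : exists c : K, mev y (p * q) = c *: e.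
  by apply: top_line; rewrite -(subnKC is_); apply: mev_homog_exp;
    rewrite ?dhomogM.
move: peE; rewrite -rmorphM /= gE !mulrDr !rmorphD /=.
rewrite [mev y (p * r)]rmorphM /= pr0 addr0 => peE.
rewrite -peE (no_low (p := p * l) (c := 1 - c)) ?add0r //.
  rewrite /l mulr_sumr; apply: msize_sum_le => d _.
  apply: leq_trans (msize_homog_le (dhomogM pi (pihomogP mdeg d g))) _.
  by rewrite -ltn_subRL.
by apply/eqP; rewrite scalerBl scale1r -cE eq_sym subr_eq eq_sym peE.
Qed.

(** Otherwise multiply p by a form complementary to its component of degree i: a polynomial of
    degree below s would take the value -e, against [no_low]. *)
Lemma mev_pihomog_eq0 p i : mev y p = 0 -> mev y (pihomog mdeg i p) = 0.
Proof.
move=> p0; apply/eqP/negPn/negP => pi0.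
have [is_ [q qd qE]] := mev_homog_dual (pihomogP mdeg i p) pi0.
have [r pE r_high] := mpoly_split_degree p i; set l := \sum_(d < _) _ in pE.
have rq0 : mev y r * mev y q = 0.
  by apply: nilp; rewrite -(subnKC is_) -addSn; apply: ideal_expM r_high _;
    apply: mev_homog_exp.
have: mev y p * mev y q = 0 by rewrite p0 mul0r.
rewrite -rmorphM {1}pE !mulrDl !rmorphD /=.
rewrite [mev y (r * q)]rmorphM /= rq0 addr0 qE.
move=> lqE; move: (lqE); rewrite (no_low (p := l * q) (c := -1)) ?add0r.
- by move=> e0; case/eqP: e_neq0.
- rewrite /l mulr_suml; apply: msize_sum_le => d _.
  apply: leq_trans (msize_homog_le (dhomogM (pihomogP mdeg d p) qd)) _.
  by rewrite -{2}(subnKC is_) ltn_add2r.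
by apply/eqP; rewrite scaleN1r -addr_eq0 lqE.
Qed.

(** A complementary form would put e in m^(i+1) m^(s-i), inside m^(s+1) = 0. *)
Lemma mev_homog_deep i p : p \is i.-homog -> mev y p \in ideal_exp m i.+1 ->
  mev y p = 0.
Proof.
move=> pi p_deep; apply/eqP/negPn/negP => /(mev_homog_dual pi)[is_ [q qd]].
rewrite rmorphM /= => qE; case/eqP: e_neq0; rewrite -qE; apply: nilp.
by rewrite -(subnKC is_) -addSn; apply: ideal_expM p_deep _;
  apply: mev_homog_exp.
Qed.

(** K[x] maps onto [A] and onto gr A; by the two preceding lemmas either kernel consists of the
    polynomials whose homogeneous components all vanish at [y]. *)
Lemma canonically_graded_of_coords : canonically_graded m.
Proof.
pose gr : {lrmorphism rees m -> assoc_gr m} := \pi_{ideal_quot _}.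
have gr_surj b : exists p, gr p = b by exists (repr b); rewrite /gr /= reprK.
have gr0 p : gr p = 0 <-> forall i, (rees_val p)`_i \in ideal_exp m i.+1.
  rewrite -[p in gr p]subr0 -(rmorph0 gr); split=> [/eqP|pP]; last first.
    by apply/eqP; rewrite rmorphB rmorph0 subr0 -(rmorph0 gr) /gr /=
      -Quotient.idealrBE subr0; apply/asboolP.
  rewrite subr0 -Quotient.idealrBE subr0 => /asboolP; exact.
apply: (@lrmorphism_of_same_kernel K {mpoly K[n]} A (assoc_gr m)
   (mev y) (gr \o mev rees_gen)).
- exact: mev_surj nilp.
- move=> b; have [f <-] := gr_surj b.
  have /asboolP fP := valP f.
  have hom i : exists p : {mpoly K[n]}, p \is i.-homog /\
      (rees_val f)`_i - mev y p \in ideal_exp m i.+1.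
    by have [p] := ideal_exp_homog yP (fP i); exists p.
  have [p pP] := choice hom.
  pose N := size (rees_val f); exists (\sum_(i < N) p i).
  apply/eqP; rewrite eq_sym -subr_eq0 /= -rmorphB; apply/eqP/gr0 => i.
  have -> (g : rees m) :
      (rees_val (f - g))`_i = (rees_val f)`_i - (rees_val g)`_i.
    exact: coefB.
  rewrite coef_rees_mev; have [pi fi] := pP i.
  suff -> : pihomog mdeg i (\sum_(i < N) p i) = if (i < N)%N then p i else 0.
    case: ltnP => [_|Ni]; first exact: fi.
    by rewrite linear0 subr0 nth_default ?rpred0.
  rewrite linear_sum; case: ltnP => [iN|Ni].
    rewrite (bigD1 (Ordinal iN)) //= pihomog_dE // big1 ?addr0 // => j ji.
    by apply: pihomog_ne0 (proj1 (pP j)).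
  rewrite big1 // => j _; apply: pihomog_ne0 (proj1 (pP j)).
  by rewrite neq_ltn (leq_trans (ltn_ord j) Ni).
move=> p /=; rewrite gr0; split=> [p0 i|p_deep].
  by rewrite coef_rees_mev mev_pihomog_eq0 ?rpred0.
rewrite (@pihomog_partitionE _ _ mdeg _ p (leqnn _)) linear_sum big1 // => d _.
apply: mev_homog_deep (pihomogP _ _ _) _.
by rewrite -coef_rees_mev.
Qed.

End GradedCriterion.

(** * Socle generator and duality in a Gorenstein algebra *)

Section GorensteinSocle.
Variables (K : fieldType) (A : comAlgType K) (m : idealr A) (s : nat).
Hypotheses (gorA : gorenstein m) (sdegA : socle_degree m s).

Lemma exp_gt_socle_degree x : x \in ideal_exp m s.+1 -> x = 0.
Proof. by have [_] := sdegA; apply. Qed.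

(** A nonzero element of m^s lies in the socle, which is a line, so the generator of the socle lies
    in m^s as well. *)
Lemma gorenstein_socleP : exists e : A,
  [/\ e != 0, e \in ideal_exp m s,
      forall x, {in m, forall a, a * x = 0} -> exists c : K, x = c *: e
    & forall a, a != 0 -> exists b, a * b = e].
Proof.
have [u [uS u_free u_span]] := gorA; pose e := u ord0.
have socleE x : {in m, forall a, a * x = 0} -> exists c : K, x = c *: e.
  move=> xS; have [|c] := u_span x; first exact/asboolP.
  by rewrite inE big_ord1 subr_eq0 => /eqP ->; exists (c ord0).
have top_socle x : x \in ideal_exp m s -> {in m, forall a, a * x = 0}.
  move=> xs a am; apply: exp_gt_socle_degree.
  by rewrite -add1n; apply: ideal_expM xs; rewrite ideal_exp1.
have e0 : e != 0.
  apply/eqP => e0; have /eqP := oner_neq0 K; apply.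
  by apply: (u_free (fun=> 1) _ ord0); rewrite big_ord1 -/e e0 scaler0 inE.
exists e; split=> //.
  have [[x xs x0] _] := sdegA; have [c xE] := socleE x (top_socle x xs).
  have c0 : c != 0 by apply: contraNneq x0 => c0; rewrite xE c0 scale0r.
  by rewrite -[e]scale1r -(mulVf c0) -scalerA -xE rpredZ.
(* Induction on a power of m killing [a]: either [a] is in the socle, hence a nonzero multiple of e,
   or some nonzero x a with x in m is killed by a smaller power. *)
have dual k : forall a, a != 0 ->
    (forall x, x \in ideal_exp m k -> a * x = 0) ->
    exists b, a * b = e.
  elim: k => [|k IHk] a a0 ak.
    by case/eqP: a0; rewrite -[a]mulr1 ak.
  have [aS|] := pselect {in m, forall x, x * a = 0}.
    have [c aE] := socleE a aS.
    have c0 : c != 0 by apply: contraNneq a0 => c0; rewrite aE c0 scale0r.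
    by exists (c^-1%:A); rewrite aE mulr_algr scalerA mulVf // scale1r.
  move=> /existsNP[x /not_implyP[xm /eqP xa0]].
  have [|b bE] := IHk _ xa0; last by exists (x * b); rewrite mulrCA mulrA.
  move=> z zk; rewrite mulrAC mulrC ak // -add1n.
  by apply: ideal_expM zk; rewrite ideal_exp1.
move=> a a0; apply: (dual s.+1) => // x /exp_gt_socle_degree ->.
by rewrite mulr0.
Qed.

End GorensteinSocle.

(** * Consequences of the values of the Hilbert function *)

Section HilbertFunction.
Variables (K : fieldType) (A : comAlgType K) (m : idealr A).

Lemma residue_field_of_hilbert0 : hilbert_is m 0 1 ->
  forall a, exists c : K, a - c%:A \in m.
Proof.
move=> [u [_ _ span]] a; pose v := u ord0.
have spanE b : exists c : K, b - c *: v \in m.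
  have [|c] := span b; first by [].
  by rewrite big_ord1 ideal_exp1; exists (c ord0).
have [c cP] := spanE 1; have [d dP] := spanE a.
have c0 : c != 0.
  by apply/eqP => c0; move: cP; rewrite c0 scale0r subr0 idealr1.
exists (d / c); rewrite (_ : a - _ = (a - d *: v) - (d / c)%:A * (1 - c *: v)).
  by rewrite rpredB // idealMr.
by rewrite mulr_algl scalerBr scalerA divfK // opprB addrA subrK.
Qed.

Lemma local_coords_exist n : (forall a, exists c : K, a - c%:A \in m) ->
  embedding_dim m n -> exists y : 'I_n -> A, local_coords m y.
Proof.
move=> resP [y [ym _ span]]; exists y; split=> // [i|a am].
  by rewrite -ideal_exp1.
by apply: span; rewrite ideal_exp1.
Qed.

(** The binomial is the dimension of the forms of degree d in n + 1 variables. Forms lifting a basis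
    of m^d / m^(d+1) are free, hence a basis of all these forms, and a form with value in m^(d+1)
    has zero coordinates. *)
Lemma hilbert_homog_free n (y : 'I_n.+1 -> A) d :
  local_coords m y -> hilbert_is m d 'C(d + n, d) ->
  forall p, p \is d.-homog -> mev y p \in ideal_exp m d.+1 -> p = 0.
Proof.
move=> yP [u [ud u_free _]] p pd p_deep.
have hom i : exists q : dhomog n.+1 K d, u i - mev y q \in ideal_exp m d.+1.
  by have [q qd uq] := ideal_exp_homog yP (ud i); exists (DHomog qd).
have [q qP] := choice hom; pose X := [tuple q i | i < 'C(d + n, d)].
have X_free (c : 'I_'C(d + n, d) -> K) :
    mev y (\sum_i c i *: mpoly_of_dhomog (q i)) \in ideal_exp m d.+1 -> forall i, c i = 0.
  move=> cX; apply: u_free.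
  rewrite -[X in X \in _](subrK (mev y (\sum_i c i *: mpoly_of_dhomog (q i)))).
  rewrite rpredD // (linear_sum (mev y)) -sumrB rpred_sum // => i _.
  by rewrite linearZ -scalerBr rpredZ.
have sumX (c : 'I_'C(d + n, d) -> K) : mpoly_of_dhomog (\sum_i c i *: X`_i) =
    \sum_i c i *: mpoly_of_dhomog (q i).
  rewrite linear_sum; apply: eq_bigr => i _.
  by rewrite -tnth_nth tnth_mktuple.
have /span_basis X_full : basis_of fullv X.
  rewrite basisEfree; apply/and3P; split; last 2 first.
  - exact: subvf.
  - by rewrite size_tuple dimvf.
  apply/freeP => c c0; apply: X_free; rewrite -sumX c0.
  by rewrite !linear0 rpred0.
have /coord_span pE : DHomog pd \in <<X>>%VS by rewrite X_full memvf.
have pX : p = \sum_i coord X i (DHomog pd) *: mpoly_of_dhomog (q i).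
  by rewrite -sumX -pE.
have c0 := X_free (fun i => coord X i (DHomog pd)).
rewrite pX big1 // => i _; rewrite c0 ?scale0r //.
by rewrite -pX.
Qed.

End HilbertFunction.

(** * Solvability of linear systems *)

Section LinearSystems.
Variable K : fieldType.

Lemma solve_square_system n (N : 'I_n -> 'I_n -> K) :
  (forall x : 'I_n -> K, (forall j, \sum_i x i * N i j = 0) ->
    forall i, x i = 0) ->
  forall c : 'I_n -> K, exists x : 'I_n -> K,
    forall j, \sum_i x i * N i j = c j.
Proof.
move=> Ninj c; pose M := \matrix_(i, j) N i j.
have mulE (v : 'rV_n) j : (v *m M) 0 j = \sum_i v 0 i * N i j.
  by rewrite mxE; apply: eq_bigr => i _; rewrite mxE.
have Mfull : row_full M.
  rewrite row_full_unit -row_free_unit; apply: inj_row_free => v vM0.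
  apply/rowP => i; rewrite mxE (Ninj (fun i => v 0 i)) // => j.
  by rewrite -mulE vM0 mxE.
have /submxP[v vE] := submx_full (\row_j c j) Mfull.
by exists (fun i => v 0 i) => j; rewrite -mulE -vE mxE.
Qed.

Lemma solve_system_free_columns h (I : finType) (N : 'I_h -> I -> K) :
  (forall d : I -> K, (forall i, \sum_b N i b * d b = 0) ->
    forall b, d b = 0) ->
  forall c : I -> K, exists x : 'I_h -> K, forall b, \sum_i x i * N i b = c b.
Proof.
move=> Ninj c; pose M := \matrix_(i < h, j < #|I|) N i (enum_val j).
have Mfull : row_full M.
  rewrite /row_full -mxrank_tr; apply: (@inj_row_free _ _ _ M^T) => v vM0.
  apply/rowP => j; rewrite mxE -[j]enum_valK.
  apply: (Ninj (fun b => v 0 (enum_rank b))) => i.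
  transitivity ((v *m M^T) 0 i); last by rewrite vM0 mxE.
  rewrite mxE (reindex_onto enum_val enum_rank) => [|b _];
    last exact: enum_rankK.
  apply: eq_big => [k|k _]; first by rewrite enum_valK eqxx.
  by rewrite !mxE enum_valK mulrC.
have /submxP[v vE] := submx_full (\row_j c (enum_val j)) Mfull.
exists (fun i => v 0 i) => b.
transitivity ((v *m M) 0 (enum_rank b)).
  by rewrite mxE; apply: eq_bigr => i _; rewrite mxE enum_rankK.
by rewrite -vE mxE enum_rankK.
Qed.

End LinearSystems.

(** * Vanishing of components of low degree *)

Section LowDegree.
Variables (K : fieldType) (A : comAlgType K) (m : idealr A).
Variables (n : nat) (y : 'I_n.+1 -> A).
Hypothesis yP : local_coords m y.

(** Strong induction on d: once the lower components are gone, the component of degree d differs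
    from p by terms with value in m^(d+1), so [hilbert_homog_free] applies to it. *)
Lemma pihomog_low_eq0 k p :
  (forall d, (d < k)%N -> hilbert_is m d 'C(d + n, d)) ->
  mev y p \in ideal_exp m k -> forall d, (d < k)%N -> pihomog mdeg d p = 0.
Proof.
move=> hilb pk; elim/ltn_ind => d IHd dk.
have [q pE q_deep] := mpoly_split_degree yP p d.
rewrite big1 in pE => [|j _]; last by rewrite IHd // (ltn_trans _ dk).
apply: (hilbert_homog_free yP (hilb d dk) (pihomogP _ _ _)).
have -> : pihomog mdeg d p = p - q by rewrite {2}pE add0r addrK.
rewrite rmorphB /= rpredB //; apply: ideal_exp_sub pk.
exact: dk.
Qed.

End LowDegree.

(** * Perturbation of coordinates by elements of m^2 *)

Section Perturbation.
Variables (K : fieldType) (A : comAlgType K) (m : idealr A).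
Variables (n : nat) (y q : 'I_n -> A).
Hypothesis yP : local_coords m y.
Hypothesis q2 : forall i, q i \in ideal_exp m 2.

Let y' i := y i + q i.

Lemma local_coords_perturb : local_coords m y'.
Proof.
have [resP ym span] := yP; split=> // [i|a am].
  by rewrite rpredD // -ideal_exp1 (ideal_exp_sub (j := 2)).
have [c cP] := span a am; exists c.
under eq_bigr => i _ do rewrite scalerDr.
rewrite big_split opprD addrA rpredB // rpred_sum // => i _.
by rewrite rpredZ.
Qed.

(* First-order Taylor expansion: a product of two [q]'s gains two orders. *)
Lemma mev_perturb mn :
  let D := \sum_i mev y ('X_[mn]^`M(i)) * q i in
  D \in ideal_exp m (mdeg mn).+1 /\
  mev y' 'X_[mn] - mev y 'X_[mn] - D \in ideal_exp m (mdeg mn).+2.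
Proof.
have [_ ym _] := yP.
move: {2}(mdeg mn) (erefl (mdeg mn)) => d; elim: d mn => [|d IHd] mn mnd D.
  have mn0 : mn = 0%MM by apply/eqP; rewrite -mdeg_eq0 mnd.
  have -> : D = 0.
    rewrite /D big1 // => i _; rewrite mderivX mn0 mnm0E.
    by rewrite scale0r rmorph0 mul0r.
  by rewrite mn0 mpolyX0 !rmorph1 !subr0 subrr !rpred0.
have [i mi] : exists i, mn i != 0%N.
  apply/existsP; apply: contra_eqT mnd => /existsPn mn0.
  rewrite mdegE big1 // => i _; apply/eqP; exact: negbNE.
have mnE : mn = (U_(i) + (mn - U_(i)))%MM.
  by rewrite addmC submK // lep1mP.
move: mnE; set mn1 := (mn - _)%MM => mnE.
have mn1d : mdeg mn1 = d.
  by move: mnd; rewrite mnE mdegD mdeg1 add1n => -[].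
have [] := IHd mn1 mn1d; rewrite mn1d; set D1 := \sum_(i < n) _ => D1d r1d.
have DE : D = q i * mev y 'X_[mn1] + y i * D1.
  rewrite /D mnE mpolyXD.
  under eq_bigr => j _ do
    rewrite mderivM rmorphD !rmorphM /= mulrDl mevXU -!mulrA.
  rewrite big_split /= -mulr_sumr; congr (_ + _).
  rewrite (bigD1 i) //= big1 => [|j ji].
    rewrite addr0 mderivX mnm1E eqxx scale1r.
    rewrite (_ : (_ - _)%MM = 0%MM) ?mpolyX0 ?rmorph1 ?mul1r 1?mulrC //.
    by apply/mnmP => j; rewrite mnmBE subnn mnm0E.
  by rewrite mderivX mnm1E eq_sym (negPf ji) scale0r rmorph0 mul0r.
have y1 : y i \in ideal_exp m 1 by rewrite ideal_exp1.
have y'1 : y' i \in ideal_exp m 1.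
  by rewrite rpredD // (ideal_exp_sub (j := 2)).
rewrite mnd; split.
  rewrite DE rpredD //; last exact: (ideal_expM y1 D1d).
  by have := ideal_expM (q2 i) (mevX_exp yP mn1); rewrite mn1d.
(* In degree d + 1 the error must have order d + 3: the summands have orders 1 + (d + 2) and 2 + (d
   + 1). *)
have -> : mev y' 'X_[mn] - mev y 'X_[mn] - D =
    y' i * (mev y' 'X_[mn1] - mev y 'X_[mn1] - D1) + q i * D1.
  rewrite DE {1 2}mnE !mevXD !mevXU /y'; ring.
by rewrite rpredD ?(ideal_expM y'1 r1d) // (ideal_expM (q2 i) D1d).
Qed.

End Perturbation.

Lemma top_power_line (K : fieldType) (A : comAlgType K) (m : idealr A)
    s (e : A) :
  (forall x, x \in ideal_exp m s.+1 -> x = 0) ->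
  (forall x, {in m, forall a, a * x = 0} -> exists c : K, x = c *: e) ->
  forall x, x \in ideal_exp m s -> exists c : K, x = c *: e.
Proof.
move=> nilp socle_line x xs; apply: socle_line => a am; apply: nilp.
by rewrite -add1n; apply: ideal_expM xs; rewrite ideal_exp1.
Qed.

(** * The annihilator of m^2 in socle degree s = r + 2 *)

Section SocleDuality.
Variables (K : fieldType) (A : comAlgType K) (m : idealr A).
Variables (n r : nat) (y : 'I_n -> A) (e : A).
Hypothesis yP : local_coords m y.
Hypothesis nilp : forall x, x \in ideal_exp m r.+3 -> x = 0.
Hypothesis e_top : e \in ideal_exp m r.+2.
Hypothesis socle_line :
  forall x, {in m, forall a, a * x = 0} -> exists c : K, x = c *: e.

Lemma socle_of_coords w : (forall x, x \in ideal_exp m 2 -> w * x = 0) ->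
  (forall j, w * y j = 0) -> exists c : K, w = c *: e.
Proof.
move=> w2 wy; apply: socle_line => a am; have [_ _ span] := yP.
have [c /w2] := span a am; rewrite mulrBr mulr_sumr big1 => [|i _].
  by rewrite subr0 mulrC.
by rewrite -scalerAr wy scaler0.
Qed.

(** Multiplication by the y_j sends both a and m^(r+1) into K e. On m^(r+1)/m^(r+2) it is a square
    matrix with trivial kernel, since a combination killed by every y_j lies in K e, inside m^(r+2).
    Hence some element of m^(r+1) has the same products with the y_j as a, and the difference is in
    the socle. *)
Lemma annihilator_exp2 : hilbert_is m r.+1 n ->
  forall a, (forall x, x \in ideal_exp m 2 -> a * x = 0) ->
  a \in ideal_exp m r.+1.
Proof.
move=> [u [ur u_free _]] a a2; have [_ ym _] := yP.
have pairE ij : exists c : K, u ij.1 * y ij.2 = c *: e.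
  apply: (top_power_line nilp socle_line).
  by rewrite -addn1; apply: ideal_expM (ur _) _; rewrite ideal_exp1.
have [N NE] := choice pairE.
have aE j : exists c : K, a * y j = c *: e.
  apply: socle_line => z zm; rewrite mulrCA a2 //.
  by apply: (@ideal_expM _ _ _ 1 1); rewrite ideal_exp1.
have [c cE] := choice aE.
have combE (x : 'I_n -> K) j :
    (\sum_i x i *: u i) * y j = (\sum_i x i * N (i, j)) *: e.
  rewrite mulr_suml scaler_suml; apply: eq_bigr => i _.
  by rewrite -scalerAl (NE (i, j)) scalerA.
have comb_r (x : 'I_n -> K) : \sum_i x i *: u i \in ideal_exp m r.+1.
  by rewrite rpred_sum // => i _; rewrite rpredZ.
have comb2 (x : 'I_n -> K) z : z \in ideal_exp m 2 ->
    (\sum_i x i *: u i) * z = 0.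
  by move=> z2; apply: nilp; rewrite -addn2; apply: ideal_expM z2.
have [x xE] : exists x : 'I_n -> K, forall j, \sum_i x i * N (i, j) = c j.
  apply: (solve_square_system (N := fun i j => N (i, j))) => x x0.
  apply: u_free.
  have [||d ->] := @socle_of_coords (\sum_i x i *: u i).
  - exact: comb2.
  - by move=> j; rewrite combE x0 scale0r.
  by rewrite rpredZ.
have [||d dE] := @socle_of_coords (a - \sum_i x i *: u i).
- by move=> z z2; rewrite mulrBl a2 // comb2 // subrr.
- by move=> j; rewrite mulrBl cE combE xE subrr.
rewrite -[a](subrK (\sum_i x i *: u i)) dE rpredD // rpredZ //.
exact: ideal_exp_sub e_top.
Qed.

End SocleDuality.

(** * Coordinates adapted to forms of degree s - 1 *)

Section AdaptedCoordinates.
Variables (K : fieldType) (A : comAlgType K) (m : idealr A).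
Variables (n r h : nat) (y : 'I_n.+1 -> A) (e : A).
Hypothesis yP : local_coords m y.
Hypothesis nilp : forall x, x \in ideal_exp m r.+3 -> x = 0.
Hypothesis e_top : e \in ideal_exp m r.+2.
Hypothesis socle_line :
  forall x, {in m, forall a, a * x = 0} -> exists c : K, x = c *: e.
Hypothesis hilb_r : hilbert_is m r 'C(r + n, r).
Hypothesis hilb_r1 : hilbert_is m r.+1 n.+1.
Hypothesis hilb_2 : hilbert_is m 2 h.

Let top := top_power_line nilp socle_line.

(** The products lie in m^(r+2), inside K e, so this is a linear system: unknown coefficients on a
    basis of m^2/m^3, one equation per monomial of degree r. *)
Lemma dual_of_monomials (c : 'X_{1..n.+1} -> K) :
  exists2 q, q \in ideal_exp m 2 &
    forall mn, mdeg mn = r -> q * mev y 'X_[mn] = c mn *: e.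
Proof.
have [u [u2 _ u_span]] := hilb_2.
pose I := {b : 'X_{1..n.+1 < r.+1} | mdeg b == r}.
pose X (b : I) : {mpoly K[n.+1]} := 'X_[val (val b)].
have Xr b : X b \is r.-homog by rewrite dhomogX; exact: (valP b).
have pairE ib : exists c : K, u ib.1 * mev y (X ib.2) = c *: e.
  apply: top; rewrite -[r.+2]add2n.
  exact: ideal_expM (u2 _) (mev_homog_exp yP (Xr _)).
have [N NE] := choice pairE.
have [d d0 b|x xE] := @solve_system_free_columns K h I (fun i b => N (i, b)) _
    (fun b => c (val (val b))).
  (* A form of degree r whose value annihilates m^2 has its value in m^(r+1),
     hence is zero: the columns of N are free. *)
  pose g := \sum_b d b *: X b.
  have gr : g \is r.-homog by rewrite rpred_sum // => b' _; rewrite rpredZ.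
  have ug i : u i * mev y g = 0.
    transitivity ((\sum_b N (i, b) * d b) *: e); last by rewrite d0 scale0r.
    rewrite linear_sum mulr_sumr scaler_suml.
    apply: eq_bigr => b' _.
    by rewrite linearZ /= -scalerAr (NE (i, b')) scalerA mulrC.
  have g0 : g = 0.
    apply: (hilbert_homog_free yP hilb_r gr).
    apply: (annihilator_exp2 yP nilp e_top socle_line hilb_r1) => z z2.
    have [a az] := u_span z z2.
    have ga0 : mev y g * \sum_i a i *: u i = 0.
      by rewrite mulr_sumr big1 // => i _; rewrite -scalerAr mulrC ug scaler0.
    rewrite -[z](subrK (\sum_i a i *: u i)) mulrDr ga0 addr0.
    by apply: nilp; rewrite -[r.+3]addn3; apply: ideal_expM az;
      apply: mev_homog_exp.
  transitivity (g@_(val (val b))); last by rewrite g0 mcoeff0.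
  rewrite linear_sum (bigD1 b) //= mcoeffZ mcoeffX eqxx mulr1 big1 ?addr0 //.
  move=> b' b'b; rewrite mcoeffZ mcoeffX (inj_eq val_inj) (inj_eq val_inj).
  by rewrite (negPf b'b) mulr0.
exists (\sum_i x i *: u i) => [|mn mnr].
  by rewrite rpred_sum // => i _; rewrite rpredZ.
have mn_lt : (mdeg mn < r.+1)%N by rewrite mnr.
have mn_r : mdeg (BMultinom mn_lt) == r by apply/eqP.
have := xE (exist _ (BMultinom mn_lt) mn_r); rewrite /= => <-.
rewrite mulr_suml scaler_suml; apply: eq_bigr => i _.
by rewrite -scalerAl -scalerA -(NE (i, _)).
Qed.

Hypothesis r1_neq0 : r.+1%:R != 0 :> K.

(** The span of [v] meets m^(r+2) only in 0, so a form of degree r + 1 whose value at [y'] is on K e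
    vanishes there. *)
Lemma adapted_coords : exists (y' v : 'I_n.+1 -> A),
  [/\ local_coords m y',
      forall c : 'I_n.+1 -> K, \sum_i c i *: v i \in ideal_exp m r.+2 ->
        forall i, c i = 0
    & forall p, p \is r.+1.-homog ->
      exists c : 'I_n.+1 -> K, mev y' p = \sum_i c i *: v i].
Proof.
have [v [vr v_free v_span]] := hilb_r1.
have decomp mn : exists c : ('I_n.+1 -> K) * K, mdeg mn = r.+1 ->
    mev y 'X_[mn] = \sum_i c.1 i *: v i + c.2 *: e.
  have [mnr|//] := pselect (mdeg mn = r.+1); last by exists (fun=> 0, 0).
  have := mevX_exp yP mn; rewrite mnr => /v_span[c /top[d dE]].
  by exists (c, d) => _ /=; rewrite -dE addrC subrK.
have [phi phiE] := choice decomp.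
have qP k := dual_of_monomials
  (fun b => - (r.+1%:R)^-1 * (phi (b + U_(k))%MM).2).
have q_ex k : exists q, q \in ideal_exp m 2 /\
    forall b, mdeg b = r -> q * mev y 'X_[b] =
      (- (r.+1%:R)^-1 * (phi (b + U_(k))%MM).2) *: e.
  by have [q] := qP k; exists q.
have [q q_spec] := choice q_ex; have q2 k := proj1 (q_spec k).
exists (fun i => y i + q i), v; split=> //.
  exact: local_coords_perturb.
have monoE mn : mdeg mn = r.+1 ->
    mev (fun i => y i + q i) 'X_[mn] = \sum_i (phi mn).1 i *: v i.
  (* The Taylor remainder lies in m^(r+3) = 0, so the first-order formula is exact. *)
  move=> mnr; have [_] := mev_perturb yP q2 mn; rewrite mnr => /nilp.
  move/eqP; rewrite -addrA -opprD subr_eq0 => /eqP ->.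
  rewrite phiE // -[RHS]addr0 -addrA; congr (_ + _).
  (* Differentiation contributes the exponent of x_k; these add up to r + 1 and cancel the
     denominator. *)
  rewrite (eq_bigr (fun k => (- (r.+1%:R)^-1 * (phi mn).2 * (mn k)%:R) *: e)).
    rewrite -scaler_suml -mulr_sumr -natr_sum -mdegE mnr mulrAC mulNr.
    by rewrite mulVf // mulN1r scaleNr subrr.
  move=> k _; rewrite mderivX linearZ /= -scalerAl.
  (* For a zero exponent, adding U_(k) does not undo the truncated subtraction, but the coefficient
     is then 0. *)
  have [->|mk] := eqVneq (mn k) 0%N; first by rewrite mulr0 !scale0r.
  have mkE : (mn - U_(k) + U_(k))%MM = mn by rewrite submK // lep1mP.
  rewrite mulrC (proj2 (q_spec k)); first by rewrite mkE scalerA mulrC.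
  by move: mnr; rewrite -{1}mkE mdegD mdeg1 addn1 => -[].
move=> p /dhomogP pr.
exists (fun i => \sum_(mn <- msupp p) p@_mn * (phi mn).1 i).
rewrite mevE big_seq.
rewrite (eq_bigr (fun mn => \sum_i (p@_mn * (phi mn).1 i) *: v i)).
  rewrite -big_seq exchange_big; apply: eq_bigr => i _.
  by rewrite scaler_suml.
move=> mn mnp; rewrite monoE ?pr // scaler_sumr.
by apply: eq_bigr => i _; rewrite scalerA.
Qed.

End AdaptedCoordinates.

(** * Extremal Gorenstein algebras *)

Section Extremal.
Variables (K : fieldType) (A : comAlgType K) (m : idealr A).

(** By symmetry the two binomials are C(n + i, n) and C(n + s - i, n), and i <= s - i. *)
Lemma hilbert_extremal_low n s i : extremal_gorenstein n.+1 s m ->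
  (i.*2 <= s)%N -> hilbert_is m i 'C(i + n, i).
Proof.
move=> [_ hilb] i2s; have is_ : (i <= s)%N by lia.
have -> : 'C(i + n, i) = minn 'C(n.+1 + i - 1, i) 'C(n.+1 + s - i - 1, s - i).
  have -> : (n.+1 + i - 1 = n + i)%N by lia.
  have -> : (n.+1 + s - i - 1 = n + (s - i))%N by lia.
  rewrite [(i + n)%N]addnC; symmetry; apply/minn_idPl.
  rewrite -[leqLHS]bin_sub ?leq_addl // -[leqRHS]bin_sub ?leq_addl // !addnK.
  by rewrite leq_bin2l // leq_add2l; lia.
exact: hilb.
Qed.

Lemma hilbert_extremal_penultimate n r : extremal_gorenstein n.+1 r.+2 m ->
  hilbert_is m r.+1 n.+1.
Proof.
move=> [_ /(_ r.+1 (leqnSn _))].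
have -> : (n.+1 + r.+2 - r.+1 - 1 = n.+1)%N by lia.
rewrite subSnn bin1 (minn_idPr _) //.
have -> : (n.+1 + r.+1 - 1 = n + r.+1)%N by lia.
rewrite -[leqRHS]bin_sub ?leq_addl // addnK -[leqLHS]bin1.
have <- : (n.+1 - n = 1)%N by lia.
by rewrite bin_sub // leq_bin2l //; lia.
Qed.

(** For n = 0 the second binomial at i = 0 is C(s, s + 1) = 0, which would put 1 in m. *)
Lemma extremal_embdim_gt0 n s : extremal_gorenstein n s.+1 m -> (0 < n)%N.
Proof.
case: n => // -[_ /(_ 0%N isT)]; rewrite bin0 subn0.
rewrite [X in minn _ X]bin_small; last by lia.
move=> [u [_ _ span]]; have [|c] := span 1; first by [].
by rewrite big_ord0 subr0 ideal_exp1 idealr1.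
Qed.

Theorem extremal_canonically_graded n s : [pchar K] =i pred0 ->
  embedding_dim m n -> socle_degree m s -> extremal_gorenstein n s m ->
  (s <= 4)%N -> canonically_graded m.
Proof.
move=> charK0 embA sdegA extA s4; have [gorA hilb] := extA.
have nilp := exp_gt_socle_degree sdegA.
have [e [e0 e_top socle_line pairing]] := gorenstein_socleP gorA sdegA.
have top := top_power_line nilp socle_line.
case: s => [|s] in sdegA extA s4 hilb nilp e_top top *.
  (* Socle degree 0, where n may be 0: the only polynomial of size 0 is 0. *)
  have resP : forall a, exists c : K, a - c%:A \in m.
    by apply: residue_field_of_hilbert0; have := hilb 0%N isT; rewrite !bin0.
  have [y yP] := local_coords_exist resP embA.
  apply: (canonically_graded_of_coords yP nilp top e0 pairing) => p c.
  by rewrite leqn0 mmeasure_poly_eq0 => /eqP ->; rewrite rmorph0.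
case: n => [|n] in embA extA hilb *; first by have := extremal_embdim_gt0 extA.
have low := hilbert_extremal_low extA.
have h0 : hilbert_is m 0 1 by have := low 0%N isT; rewrite bin0.
have [y yP] := local_coords_exist (residue_field_of_hilbert0 h0) embA.
case: s => [|r] in sdegA extA s4 hilb nilp e_top top low *.
  (* Socle degree 1: p is a constant with value in m, hence 0. *)
  apply: (canonically_graded_of_coords yP nilp top e0 pairing) => p c p1 pE.
  rewrite (@pihomog_partitionE _ _ mdeg _ p p1) big_ord1.
  rewrite (@pihomog_low_eq0 _ _ _ _ _ yP 1) ?rmorph0 ?pE ?rpredZ //.
  by move=> d; rewrite ltnS leqn0 => /eqP ->; apply: low.
(* The bound s <= 4 enters here: with it, d <= s - 2 gives 2 d <= s. *)
have low_r d : (d < r.+1)%N -> hilbert_is m d 'C(d + n, d).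
  by move=> dr; apply: low; lia.
have r1_neq0 : r.+1%:R != 0 :> K by rewrite ((pcharf0P K).1 charK0).
have [y' [v [y'P v_free y'_hom]]] := adapted_coords yP nilp e_top socle_line
  (low_r r (leqnn _)) (hilbert_extremal_penultimate extA)
  (hilb 2%N isT) r1_neq0.
apply: (canonically_graded_of_coords y'P nilp top e0 pairing) => p c pr pE.
(* The value of p lies in m^(r+1), so its components of degree at most r vanish, and its degree is
   at most r + 1. *)
have pE' : p = pihomog mdeg r.+1 p.
  rewrite {1}(@pihomog_partitionE _ _ mdeg _ p pr) big_ord_recr /=.
  rewrite big1 ?add0r //.
  move=> d _; apply: (pihomog_low_eq0 y'P low_r) => //.
  by rewrite pE rpredZ // (ideal_exp_sub (leqnSn _)).
have [d dE] := y'_hom _ (pihomogP mdeg r.+1 p); rewrite -pE' in dE.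
rewrite dE big1 // => i _; rewrite (v_free d) ?scale0r // -dE pE.
by rewrite rpredZ.
Qed.

End Extremal.

Theorem theorem3p1 (K : closedFieldType) (charK0 : [pchar K] =i pred0)
    (n s : nat) (I : idealr {fps K[n]}) :
  let A : comAlgType K := {ideal_quot I} in
  let m : idealr A := @quot_max n K I in
  artinian A -> embedding_dim m n -> socle_degree m s ->
  extremal_gorenstein n s m -> (s <= 4)%N ->
  canonically_graded m.
Proof.
move=> A m _; exact: extremal_canonically_graded.
Qed.
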